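(* For every $k\ge3$ there is a graph $G$ with $\mathrm{cstw}(G)\le3$ and $\mathrm{ctdw}(G)\ge k$.
   Context: A strong tree decomposition of $G=(V,E)$ is $(\{X_i\}_{i\in I},T=(I,F))$ where $\{X_i\}$ partitions $V$ and $T$ is a tree such that each edge has both ends in one bag or in bags of two adjacent tree nodes; its width is the maximum bag size. $\mathrm{cstw}(G)$ (connected strong tree width) is the minimum width of a strong tree decomposition in which each bag induces a connected subgraph. A tree distance decomposition is a strong tree decomposition with root $r$ such that each $v\in X_i$, $i\neq r$, has a neighbor in the bag of the parent of $i$; $\mathrm{ctdw}(G)$ (root-connected tree distance width) is the minimum width of a tree distance decomposition whose root bag induces a connected subgraph. *)

(* Defs.v *)
From mathcomp Require Import all_boot.
Set Implicit Arguments.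
Unset Strict Implicit.
Unset Printing Implicit Defensive.

Record sgraph := SGraph {
  vertex :> finType;
  adj : rel vertex;
  adj_sym : symmetric adj;
  adj_irrefl : irreflexive adj
}.

Definition induced_rel (G : sgraph) (A : {set G}) : rel G :=
  [rel x y | [&& x \in A, y \in A & adj x y]].

Definition induces_connected (G : sgraph) (A : {set G}) : Prop :=
  A != set0 /\ {in A &, forall x y, connect (induced_rel A) x y}.

(* The size bound excludes the closed walk [:: x; y] along a single edge. *)
Definition acyclic (G : sgraph) : Prop :=
  forall c : seq G, 2 < size c -> ~~ ucycleb (@adj G) c.

Definition is_tree (G : sgraph) : Prop :=
  induces_connected [set: G] /\ acyclic G.

(* [p] is the second vertex of a simple path from [i] to the root [r]. *)
Definition is_parent (T : sgraph) (r p i : T) : Prop :=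
  exists q : seq T,
    [/\ path (@adj T) i (p :: q), last p q = r & uniq (i :: p :: q)].

Record strong_tree_decomposition (G : sgraph) := StrongTreeDecomposition {
  dtree : sgraph;
  dtreeP : is_tree dtree;
  bag : dtree -> {set G};
  bag_inj : injective bag;
  bag_partition : partition [set bag i | i : dtree] [set: G];
  bag_adj : forall (u v : G) (i j : dtree),
    u \in bag i -> v \in bag j -> adj u v -> i = j \/ adj i j
}.

Definition width (G : sgraph) (D : strong_tree_decomposition G) : nat :=
  \max_(i : dtree D) #|bag i|.

Definition is_tree_distance_decomposition (G : sgraph)
    (D : strong_tree_decomposition G) (r : dtree D) : Prop :=
  forall (i : dtree D) (v : G), i != r -> v \in bag i ->
    exists p : dtree D, is_parent r p i /\ exists2 u, u \in bag p & adj v u.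

Definition is_min (P : nat -> Prop) (w : nat) : Prop :=
  P w /\ forall m, P m -> w <= m.

(* Both parameters are rendered relationally: [is_cstw G w] reads *)
(* "cstw(G) is defined and equals w", and likewise for [is_ctdw]. *)
Definition is_cstw (G : sgraph) : nat -> Prop :=
  is_min (fun w => exists D : strong_tree_decomposition G,
    (forall i : dtree D, induces_connected (bag i)) /\ width D = w).

(* Every vertex of a tree distance decomposition is joined to the root bag, *)
(* so a disconnected graph has no decomposition with a connected root bag *)
(* and satisfies [is_ctdw G w] for no [w]. *)
Definition is_ctdw (G : sgraph) : nat -> Prop :=
  is_min (fun w => exists (D : strong_tree_decomposition G) (r : dtree D),
    [/\ is_tree_distance_decomposition r, induces_connected (bag r)
      & width D = w]).

(* Main.v *)
(** In a tree distance decomposition every vertex outside the root bag has a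
    neighbour one level higher, where the level of a vertex is the depth of its
    bag.  Let [H] be a connected set missing the root bag, all of whose vertices
    are adjacent to a vertex [a] outside [H], with no other edge leaving [H].  A
    vertex of minimal level in [H] sees the level above it only through [a], so
    all of [H] lies exactly one level below [a]; being connected, [H] lies in a
    single bag.

    The graph [gadget_graph k] consists of a centre joined to vertices
    [a_0, ..., a_(k-1)], where each [a_i] is adjacent to all vertices of a star
    [H_i] with centre [b_i] and [k] leaves.  A root bag with fewer than [k]
    vertices misses some [H_i], which then forces a bag with more than [k]
    vertices.  With the bags [{a_i, b_i}] and singletons otherwise, one gets
    connected bags of size at most 2. *)
Require Import Defs.
From mathcomp Require Import all_boot.
From Stdlib Require Import Classical.
Set Implicit Arguments.
Unset Strict Implicit.
Unset Printing Implicit Defensive.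

(** [P] is an arbitrary predicate, possibly undecidable, so the descent to a minimum uses excluded
    middle. *)
Lemma exists_is_min (P : nat -> Prop) (n : nat) :
  P n -> exists2 w, is_min P w & w <= n.
Proof.
elim/ltn_ind: n => n IHn Pn.
have [[m [lt_mn Pm]]|no_lt] := classic (exists m, m < n /\ P m).
  by have [w minw le_wm] := IHn m lt_mn Pm; exists w => //; exact: leq_trans le_wm (ltnW lt_mn).
exists n => //; split=> // m Pm; rewrite leqNgt; apply/negP => lt_mn.
by apply: no_lt; exists m.
Qed.

(** * Simple paths and depth in trees *)

(** If the paths diverge after [x], to [y] and [z], their remainders avoid [x] and meet at the
    common end. A simple path from [y] to [z] avoiding [x] then closes up through [x] to a cycle. *)
Lemma acyclic_uniq_path_inj (T : sgraph) (x : T) (p q : seq T) :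
  acyclic T -> path (@adj T) x p -> path (@adj T) x q ->
  uniq (x :: p) -> uniq (x :: q) -> last x p = last x q -> p = q.
Proof.
move=> acT; elim: p x q => [|y p IHp] x [|z q] //=.
- by move=> _ _ _ /andP[xNq _] xE; rewrite xE mem_last in xNq.
- by move=> _ _ /andP[xNp _] _ xE; rewrite -xE mem_last in xNp.
move=> /andP[xy yp] /andP[xz zq] /andP[xNp up] /andP[xNq uq] lastE.
have [yz|y_neq_z] := eqVneq y z.
  by rewrite -yz in zq uq lastE *; rewrite (IHp y q).
(* Adjacency in [T] with [x] deleted. *)
pose e : rel T := [rel u v | [&& u != x, v != x & adj u v]].
have e_sym : connect_sym e.
  by apply: sym_connect_sym => u v; rewrite /e /= adj_sym andbCA.
have avoid u s : path (@adj T) u s -> x \notin u :: s -> connect e u (last u s).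
  elim: s u => [|v s IHs] u /=; first by rewrite connect0.
  case/andP=> uv vs; rewrite inE negb_or => /andP[xu xNs].
  apply: connect_trans (IHs v vs xNs).
  move: xNs; rewrite inE negb_or => /andP[xv _].
  by apply: connect1; rewrite /e /= eq_sym xu eq_sym xv.
have /connectP[s0 ys0 zE] : connect e y z.
  apply: connect_trans (avoid y p yp xNp) _.
  by rewrite lastE e_sym avoid.
case/shortenP: ys0 zE => s ys us _ zE.
have xNs : x \notin y :: s.
  rewrite inE negb_or; apply/andP; split.
    by move: xNp; rewrite inE negb_or => /andP[].
  elim: s y {us zE xy yp xNp up y_neq_z IHp lastE} ys => [|v s IHs] u //=.
  case/andP=> /and3P[_ vx _] vs.
  by rewrite inE negb_or eq_sym vx (IHs v).
(* Since [y] and [z] differ, the cycle [x :: y :: s] has at least three vertices, as [acyclic]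
   demands. *)
have s_gt0 : 0 < size s.
  by case: s zE {ys us xNs} => //= zE; rewrite zE eqxx in y_neq_z.
have /negP[] := acT [:: x, y & s] s_gt0.
apply/andP; split; last by rewrite /= xNs.
rewrite /= rcons_path xy -zE adj_sym xz andbT.
by apply: sub_path ys => u v /and3P[].
Qed.

(** The depth is the length of the unique simple path to [r]. For an edge [i j], either the path
    from [i] avoids [j] and extends to one from [j], or its tail from [j] can be reached directly
    from [i]. *)
Lemma tree_depth (T : sgraph) (r : T) : is_tree T ->
  exists d : T -> nat,
    (forall i p, is_parent r p i -> d i = (d p).+1) /\
    (forall i j, adj i j -> d i = (d j).+1 \/ d j = (d i).+1).
Proof.
move=> [[_ conT] acT].
pose to_r i (q : seq T) :=
  [&& path (@adj T) i q, last i q == r & uniq (i :: q)].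
have ex_q i : exists q, to_r i q.
  have /connectP[q0 iq0 rE] := conT i r (in_setT i) (in_setT r).
  case/shortenP: iq0 rE => q iq uq _ rE; exists q; rewrite /to_r -rE eqxx uq !andbT.
  by apply: sub_path iq => u v /and3P[].
have to_r_inj i p q : to_r i p -> to_r i q -> p = q.
  move=> /and3P[ip /eqP lp up] /and3P[iq /eqP lq uq].
  by apply: acyclic_uniq_path_inj acT ip iq up uq _; rewrite lp.
pose d i := size (xchoose (ex_q i)).
have dE i q : to_r i q -> d i = size q.
  by move=> iq; rewrite /d (to_r_inj i _ q (xchooseP (ex_q i)) iq).
exists d; split=> [i p [q [ipq lq upq]]|i j ij].
  rewrite (dE i (p :: q)) ?(dE p q) //; last by apply/and3P; split=> //; apply/eqP.
  move: ipq upq => /andP[_ pq] /andP[_ uq].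
  by apply/and3P; split=> //; apply/eqP.
have [q iq] := ex_q i; have /and3P[piq /eqP lq uq] := iq.
have [jq|jNq] := boolP (j \in i :: q); last first.
  right; rewrite (dE i q) // (dE j (i :: q)) //.
  by apply/and3P; split; rewrite /= ?(adj_sym j) ?ij ?lq ?jNq.
left; move: jq; rewrite inE => /predU1P[ji|jq].
  by rewrite ji adj_irrefl in ij.
case/splitPr: jq iq piq lq uq => q1 q2 iq.
rewrite cat_path last_cat /= => /and3P[_ _ jq2] lq.
rewrite mem_cat cat_uniq /= !inE !negb_or.
case/and5P=> /and3P[_ iNj iNq2] _ _ jNq2 uq2.
have jq2P : to_r j q2 by apply/and3P; split; rewrite ?lq //= jNq2.
have ijq2P : to_r i (j :: q2).
  by apply/and3P; split; rewrite /= ?ij ?lq // inE negb_or iNj iNq2 jNq2.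
by rewrite (dE i (j :: q2)) // (dE j q2).
Qed.

(** * Levels in a tree distance decomposition *)

Lemma bag_exists (G : sgraph) (D : strong_tree_decomposition G) (v : G) :
  exists i : dtree D, v \in bag i.
Proof.
have /and3P[/eqP covD _ _] := bag_partition D.
have : v \in cover [set bag i | i : dtree D] by rewrite covD inE.
by case/bigcupP=> _ /imsetP[i _ ->] vi; exists i.
Qed.

Lemma tree_distance_one_bag (G : sgraph) (D : strong_tree_decomposition G)
    (r : dtree D) (H : {set G}) (a : G) :
  is_tree_distance_decomposition r -> induces_connected H ->
  [disjoint H & bag r] ->
  {in H, forall x, adj x a} ->
  {in H, forall x y, adj x y -> y \in H \/ y = a} ->
  exists i : dtree D, H \subset bag i.
Proof.
move=> tddD [/set0Pn[b bH] conH] Hr Ha Hout.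
have [d [d_parent d_adj]] := tree_depth r (dtreeP D).
pose loc v := xchoose (bag_exists D v).
have locP v : v \in bag (loc v) := xchooseP (bag_exists D v).
have locE v i : v \in bag i -> loc v = i.
  move=> vi; apply: (@bag_inj _ D).
  have /and3P[_ /trivIsetP tI _] := bag_partition D.
  apply/eqP/negPn/negP => neq_bag.
  have in_bags (j : dtree D) : bag j \in [set bag i | i : dtree D] by apply/imsetP; exists j.
  have /pred0P/(_ v) := tI _ _ (in_bags _) (in_bags _) neq_bag.
  by rewrite /= locP vi.
pose lev v := d (loc v).
have up x : x \in H -> exists2 u, adj x u & lev x = (lev u).+1.
  move=> xH; have neq_r : loc x != r.
    apply/eqP => xr; have := locP x; rewrite xr.
    by rewrite (disjointFr Hr xH).
  have [p [px [u up xu]]] := tddD _ _ neq_r (locP x).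
  by exists u => //; rewrite /lev (locE u p up); apply: d_parent.
have [m mH m_min] := arg_minnP lev bH.
have lev_m : lev m = (lev a).+1.
  have [u mu lev_u] := up m mH; have [uH|<- //] := Hout m mH u mu.
  by have := m_min u uH; rewrite lev_u ltnn.
have lev_H x : x \in H -> lev x = (lev a).+1.
  (* Minimality of [m] bounds the level from below; the edge from [x] to [a] changes the level by at
     most one and so bounds it from above. *)
  move=> xH; apply/eqP; rewrite eqn_leq -{2}lev_m m_min // andbT /lev.
  have [->|/d_adj[]] := bag_adj (locP x) (locP a) (Ha x xH).
  - exact: leqnSn.
  - by move=> ->.
  - by move=> ->; rewrite leqW.
exists (loc b); apply/subsetP => x xH.
suff -> : loc b = loc x by apply: locP.
have /connectP[p bp ->] := conH b x bH xH.
elim: p b bp {bH} => //= y p IHp b /andP[/and3P[bH yH bby] yp].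
rewrite -(IHp y yp).
(* Adjacent tree nodes differ in depth, so an edge between vertices of equal level stays in one
   bag. *)
have [//|/d_adj] := bag_adj (locP b) (locP y) bby.
have := lev_H b bH; rewrite -(lev_H y yH) /lev => ->.
by case=> /n_Sn.
Qed.

(** * Trees given by a parent function *)

Section ParentGraph.

Variables (V : finType) (par : V -> V).

Definition parent_adj : rel V :=
  [rel x y | (x != y) && ((par x == y) || (par y == x))].

Lemma parent_adj_sym : symmetric parent_adj.
Proof. by move=> x y; rewrite /parent_adj /= eq_sym orbC. Qed.

Lemma parent_adj_irrefl : irreflexive parent_adj.
Proof. by move=> x; rewrite /parent_adj /= eqxx. Qed.

Definition parent_graph := SGraph parent_adj_sym parent_adj_irrefl.

Variables (root : V) (rank : V -> nat).
Hypothesis rank_par : forall x, x != root -> rank (par x) < rank x.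
Hypothesis par_root : par root = root.

Lemma parent_graph_connected (x : V) : connect parent_adj x root.
Proof.
have [n] := ubnP (rank x); elim: n x => // n IHn x lt_xn.
have [->|xNr] := eqVneq x root; first exact: connect0.
have lt_px := rank_par xNr.
apply: connect_trans (IHn (par x) _); last exact: leq_trans lt_px _.
apply: connect1; rewrite /parent_adj /= eqxx andbT.
by apply: contraTneq lt_px => <-; rewrite ltnn.
Qed.

(* Both cycle neighbours of a vertex of maximal rank would be its parent. *)
Lemma parent_graph_acyclic : acyclic parent_graph.
Proof.
move=> c c_gt2; apply/negP => /andP[cyc uc].
have [x0 x0c] : exists x0, x0 \in c.
  by case: c c_gt2 {cyc uc} => // x0 c _; exists x0; rewrite mem_head.
have [x xc x_max] := @arg_maxnP V x0 (mem c) rank x0c.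
have nbr y : y \in c -> parent_adj x y -> y = par x.
  move=> yc /= /andP[xy /orP[/eqP-> //|/eqP yx]].
  have yNr : y != root.
    by apply: contraNneq xy => yr; rewrite -yx yr par_root.
  by have := x_max y yc; rewrite /= leqNgt -yx rank_par.
have [i c' cE] := rot_to xc.
have : cycle parent_adj (x :: c') by rewrite -cE rot_cycle.
have : uniq (x :: c') by rewrite -cE rot_uniq.
have : 2 < size (x :: c') by rewrite -cE size_rot.
have memc y : y \in c' -> y \in c.
  by move=> yc'; rewrite -(mem_rot i) cE inE yc' orbT.
case/lastP: c' memc {cE} => [|[|y s] z] // memc _.
case/and3P=> _ yNs _.
rewrite /cycle rcons_path last_rcons => /andP[/andP[xy _] zx].
have yE : y = par x by apply: nbr xy; rewrite memc ?mem_head.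
have zE : z = par x.
  by apply: nbr; rewrite ?memc ?mem_rcons ?mem_head // parent_adj_sym.
by rewrite yE zE mem_rcons mem_head in yNs.
Qed.

Lemma parent_graph_tree : is_tree parent_graph.
Proof.
split; last exact: parent_graph_acyclic.
split=> [|x y _ _]; first by apply/set0Pn; exists root; rewrite inE.
have adjE : induced_rel [set: parent_graph] =2 parent_adj.
  by move=> u v; rewrite /induced_rel /= !inE.
rewrite (eq_connect adjE); apply: connect_trans (parent_graph_connected x) _.
rewrite (sym_connect_sym parent_adj_sym); exact: parent_graph_connected.
Qed.

End ParentGraph.

(** * Strong tree decompositions from maps onto a tree *)

Section FiberDecomposition.

Variables (G T : sgraph) (f : G -> T).
Hypothesis treeT : is_tree T.
Hypothesis f_surj : forall t, exists x, f x = t.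
Hypothesis f_adj : forall u v, adj u v -> f u = f v \/ adj (f u) (f v).

Definition fiber (t : T) : {set G} := [set x | f x == t].

Lemma fiber_inj : injective fiber.
Proof.
move=> s t /setP fE; have [x xs] := f_surj s.
by have := fE x; rewrite !inE xs eqxx => /esym/eqP.
Qed.

Lemma fiber_partition : partition [set fiber t | t : T] [set: G].
Proof.
apply/and3P; split.
- rewrite eqEsubset subsetT; apply/subsetP => x _; apply/bigcupP.
  by exists (fiber (f x)); rewrite ?imset_f ?inE.
- apply/trivIsetP => _ _ /imsetP[s _ ->] /imsetP[t _ ->] neq_st.
  apply/pred0P => x /=; rewrite !inE; apply/negP => /andP[/eqP xs /eqP xt].
  by rewrite -xs -xt eqxx in neq_st.
- apply/imsetP => -[t _ /esym/eqP]; apply/negP/set0Pn.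
  by have [x xt] := f_surj t; exists x; rewrite inE xt.
Qed.

Lemma fiber_adj (u v : G) (s t : T) :
  u \in fiber s -> v \in fiber t -> adj u v -> s = t \/ adj s t.
Proof. by rewrite !inE => /eqP<- /eqP<-; apply: f_adj. Qed.

(** Surjectivity of [f] keeps the bags nonempty and distinct. *)
Definition fiber_decomposition : strong_tree_decomposition G :=
  StrongTreeDecomposition treeT fiber_inj fiber_partition fiber_adj.

End FiberDecomposition.

(** * The gadget graph and its connected decomposition *)

(* [None] is the centre, [Some (i, None)] stands for [a_i] (as a vertex) or for
   [{a_i, b_i}] (as a bag), and [Some (i, Some j)] for the [j]-th leaf of [H_i]. *)
Definition gadget_node (k : nat) : finType := option ('I_k * option 'I_k).

Definition gadget_par (k : nat) (t : gadget_node k) : gadget_node k :=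
  if t is Some (i, Some _) then Some (i, None) else None.

Definition gadget_rank (k : nat) (t : gadget_node k) : nat :=
  if t is Some (_, o) then (o : bool).+1 else 0.

(** This tree serves twice: as the decomposition tree, and as the subgraph of the gadget graph to
    which only the edges at the [b_i] are added. *)
Definition gadget_tree (k : nat) : sgraph := parent_graph (@gadget_par k).

Lemma gadget_treeP (k : nat) : is_tree (gadget_tree k).
Proof.
apply: (@parent_graph_tree _ _ None (@gadget_rank k)) => //.
by case=> [[i [j|]]|].
Qed.

(* [inr i] is the star centre [b_i]. *)
Definition gadget_adj (k : nat) : rel (gadget_node k + 'I_k)%type :=
  fun x y => match x, y with
  | inl s, inl t => parent_adj (@gadget_par k) s t
  | inl s, inr i | inr i, inl s => if s is Some (j, _) then j == i else false
  | inr _, inr _ => false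
  end.

Lemma gadget_adj_sym (k : nat) : symmetric (@gadget_adj k).
Proof.
by move=> [s|i] [t|j] //; apply: parent_adj_sym.
Qed.

Lemma gadget_adj_irrefl (k : nat) : irreflexive (@gadget_adj k).
Proof. by case=> [t|i] //; apply: parent_adj_irrefl. Qed.

Definition gadget_graph (k : nat) : sgraph :=
  SGraph (@gadget_adj_sym k) (@gadget_adj_irrefl k).

Definition gadget_bag (k : nat) (x : gadget_graph k) : gadget_tree k :=
  match x with inl t => t | inr i => Some (i, None) end.

Lemma gadget_bag_adj (k : nat) (u v : gadget_graph k) :
  adj u v -> gadget_bag u = gadget_bag v \/ adj (gadget_bag u) (gadget_bag v).
Proof.
case: u v => [s|i] [t|j] //=; first by right.
- case: s => [[i [l|]]|] // /eqP->; last by left.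
  by right; rewrite /parent_adj /= eqxx andbT; apply/eqP.
- case: t => [[j [l|]]|] // /eqP->; last by left.
  by right; rewrite /parent_adj /= eqxx andbT; apply/eqP.
Qed.

Definition gadget_decomposition (k : nat) :
    strong_tree_decomposition (gadget_graph k) :=
  fiber_decomposition (gadget_treeP k)
    (fun t => ex_intro _ (inl t : gadget_graph k) erefl)
    (@gadget_bag_adj k).

Lemma gadget_bag_connected (k : nat) (t : dtree (gadget_decomposition k)) :
  induces_connected (bag t).
Proof.
split=> [|x y xt yt].
  by apply/set0Pn; exists (inl t); rewrite inE.
have [->|xNy] := eqVneq x y; first exact: connect0.
apply: connect1; rewrite /induced_rel /= xt yt /=.
move: xt yt xNy; rewrite !inE => /eqP<- /eqP.
case: x y => [s|i] [s'|j] //=.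
- by move->; rewrite eqxx.
- by move=> <-; rewrite eqxx.
- by move=> ->; rewrite eqxx.
- by case=> ->; rewrite eqxx.
Qed.

Lemma gadget_width (k : nat) : width (gadget_decomposition k) <= 2.
Proof.
apply/bigmax_leqP => t _.
(* An upper bound for the bag is enough: over a leaf [inr i] lies outside the bag, and over the
   centre the pair collapses to one vertex. *)
pose star_centre := if t is Some (i, _) then inr i else inl None : gadget_graph k.
apply: (@leq_trans #|[set inl t; star_centre]|); last first.
  by rewrite cards2; case: (_ != _).
apply/subset_leq_card/subsetP => x; rewrite !inE => /eqP tE.
by case: x tE => [s|i] /= tE; rewrite /star_centre -tE eqxx ?orbT.
Qed.

Lemma gadget_graph_connected (k : nat) : induces_connected [set: gadget_graph k].
Proof.
split=> [|x y _ _]; first by apply/set0Pn; exists (inl None); rewrite inE.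
have adjE : induced_rel [set: gadget_graph k] =2 @gadget_adj k.
  by move=> u v; rewrite /induced_rel /= !inE.
rewrite (eq_connect adjE).
(* Tree paths lift along [inl]; each [b_i] then reaches the centre through [a_i]. *)
have to_centre t : connect (@gadget_adj k) (inl t) (inl None).
  have [[_ conT] _] := gadget_treeP k.
  have /connectP[p tp ->] := conT t None (in_setT _) (in_setT _); elim: p t tp => [|s p IHp] t /=.
    by rewrite connect0.
  case/andP=> /and3P[_ _ ts] sp; apply: connect_trans (IHp s sp).
  exact: connect1.
have to_centre' z : connect (@gadget_adj k) z (inl None).
  case: z => [t|i] //; apply: connect_trans (to_centre (Some (i, None))).
  by apply: connect1; rewrite /= eqxx.
apply: connect_trans (to_centre' x) _.
by rewrite (sym_connect_sym (@gadget_adj_sym k)).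
Qed.

(** * The stars and the lower bound *)

Definition gadget_star (k : nat) (i : 'I_k) : {set gadget_graph k} :=
  inr i |: [set inl (Some (i, Some j)) | j : 'I_k].

Lemma gadget_starP (k : nat) (i : 'I_k) (x : gadget_graph k) :
  reflect (x = inr i \/ exists j, x = inl (Some (i, Some j)))
          (x \in gadget_star i).
Proof.
apply: (iffP setU1P) => -[->|]; try by left.
  by case/imsetP=> j _ ->; right; exists j.
by case=> j ->; right; apply: imset_f.
Qed.

Lemma card_gadget_star (k : nat) (i : 'I_k) : k < #|gadget_star i|.
Proof.
rewrite cardsU1 card_imset ?card_ord => [|j l [] //].
by case: imsetP => [[]|].
Qed.

Lemma gadget_star_connected (k : nat) (i : 'I_k) :
  induces_connected (gadget_star i).
Proof.
have centre : inr i \in gadget_star i by apply/gadget_starP; left.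
split=> [|x y xH yH]; first by apply/set0Pn; exists (inr i).
have symH : symmetric (induced_rel (gadget_star i)).
  by move=> u v; rewrite /induced_rel /= andbCA gadget_adj_sym.
have to_centre z : z \in gadget_star i ->
    connect (induced_rel (gadget_star i)) z (inr i).
  move=> zH; have [->|[j zE]] := gadget_starP _ _ zH; first exact: connect0.
  by apply: connect1; rewrite /induced_rel /= zH centre zE /= eqxx.
by apply: connect_trans (to_centre x xH) _; rewrite (sym_connect_sym symH) to_centre.
Qed.

Lemma gadget_star_apex (k : nat) (i : 'I_k) :
  {in gadget_star i, forall x, adj x (inl (Some (i, None)) : gadget_graph k)}.
Proof.
move=> x /gadget_starP[->|[j ->]]; first exact: eqxx.
by rewrite /= /parent_adj /= eqxx andbT; apply/eqP.
Qed.

Lemma gadget_star_boundary (k : nat) (i : 'I_k) :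
  {in gadget_star i, forall x y, adj x y ->
     y \in gadget_star i \/ y = inl (Some (i, None))}.
Proof.
move=> x /gadget_starP[->|[j ->]] [t|l] //=.
- case: t => [[i' [l|]]|] // /eqP->; last by right.
  by left; apply/gadget_starP; right; exists l.
- case/andP=> _ /orP[/eqP<-|]; first by right.
  by case: t => [[i' [l|]]|] // /eqP.
- by move=> /eqP->; left; apply/gadget_starP; left.
Qed.

(** Pigeonhole: [index] maps each vertex to the number of its gadget, and the centre to [None], so
    [S] meets fewer than [k] gadgets. *)
Lemma gadget_star_avoids (k : nat) (S : {set gadget_graph k}) :
  #|S| < k -> exists i, [disjoint gadget_star i & S].
Proof.
move=> ltSk.
pose index (x : gadget_graph k) : option 'I_k :=
  match x with inl t => omap fst t | inr i => Some i end.
have [i iS] : exists i, Some i \notin [set index x | x in S].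
  apply/existsP; rewrite -negb_forall; apply: contraL ltSk => /forallP allS.
  rewrite -leqNgt; apply: leq_trans (leq_imset_card index S).
  rewrite -[X in X <= _]card_ord -(card_imset predT (@Some_inj _)).
  by apply/subset_leq_card/subsetP => _ /imsetP[i _ ->].
exists i; apply/pred0P => x /=; apply: contraNF iS => /andP[xH xS].
apply/imsetP; exists x => //.
by have [->|[j ->]] := gadget_starP _ _ xH.
Qed.

Lemma gadget_tree_distance_width (k : nat)
    (D : strong_tree_decomposition (gadget_graph k)) (r : dtree D) :
  is_tree_distance_decomposition r -> k <= width D.
Proof.
move=> tddD; have le_width (i : dtree D) : #|bag i| <= width D.
  exact: (leq_bigmax (F := fun i : dtree D => #|bag i|)).
have [le_kr|/gadget_star_avoids[i disj_r]] := leqP k #|bag r|.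
  exact: leq_trans (le_width r).
have [j sub_j] := tree_distance_one_bag tddD (gadget_star_connected i) disj_r
  (@gadget_star_apex k i) (@gadget_star_boundary k i).
apply: leq_trans (le_width j); apply: leq_trans (subset_leq_card sub_j).
exact/ltnW/card_gadget_star.
Qed.

(** * Existence of the minimum and conclusion *)

Lemma unit_tree : is_tree (parent_graph (id : unit -> unit)).
Proof. by apply: (@parent_graph_tree _ _ tt (fun=> 0)) => // -[]. Qed.

(** A single bag works, the condition on non-root nodes being vacuous. This makes the minimum in
    [is_ctdw] exist. *)
Lemma tree_distance_decomposition_exists (G : sgraph) :
  induces_connected [set: G] ->
  exists (D : strong_tree_decomposition G) (r : dtree D),
    is_tree_distance_decomposition r /\ induces_connected (bag r).
Proof.
move=> conG; have /set0Pn[x0 _] := conG.1.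
pose T := parent_graph (id : unit -> unit).
have surj (t : T) : exists x : G, tt = t by exists x0; case: t.
exists (@fiber_decomposition G T (fun=> tt) unit_tree surj
          (fun _ _ _ => or_introl erefl)), tt.
split; first by case.
by rewrite (_ : bag _ = [set: G]) //; apply/setP => x; rewrite !inE.
Qed.

Theorem theorem9 (k : nat) (hk : 3 <= k) :
  exists G : sgraph,
    (exists w : nat, is_cstw G w /\ w <= 3) /\
    (exists w : nat, is_ctdw G w /\ k <= w).
Proof.
exists (gadget_graph k); split.
- have [w minw le_w] : exists2 w, is_cstw (gadget_graph k) w &
      w <= width (gadget_decomposition k).
    apply: exists_is_min; exists (gadget_decomposition k); split=> //.
    exact: gadget_bag_connected.
  exists w; split=> //; apply: leq_trans le_w _.
  exact: leq_trans (gadget_width k) _.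
- have [D [r [tddD conr]]] :=
    tree_distance_decomposition_exists (gadget_graph_connected k).
  have [w minw _] : exists2 w, is_ctdw (gadget_graph k) w & w <= width D.
    by apply: exists_is_min; exists D, r.
  exists w; split=> //.
  (* The minimum is the width of some [D'], so the bound for all decompositions applies to it. *)
  have [[D' [r' [tddD' _ <-]]] _] := minw.
  exact: gadget_tree_distance_width tddD'.
Qed.
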